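(* Let $d\ge 3$, let $A_0B_0$ and $A_1B_1$ be unit segments in $\mathbb{R}^d$, and let $h\ge 0$ be the distance between the lines containing them. Assume that the angle between the directions $\overrightarrow{A_0B_0}$ and $\overrightarrow{A_1B_1}$ is $\theta$, with $0<|\theta|\le\pi$. Then every continuous rigid motion transforming $A_0B_0$ into $A_1B_1$ (taking $A_0$ to $A_1$ and $B_0$ to $B_1$) satisfies $$L(A_0B_0,A_1B_1)\ge F(\theta,h),$$ where $$F(\theta,h)=\min_{0\le z\le 1}\,\max\left\{\sqrt{4\left(\max\{h,z\}\right)^2+\ell(z)^2},\ 2\arccos\left(\sqrt{1-z^2}\,\cos\frac{\theta}{2}\right)\right\}$$ and $$\ell(z)=\begin{cases}2z+\sqrt{1-z^2}\,\bigl(|\theta|-2\arcsin z\bigr), & 0\le z\le \sin\frac{|\theta|}{2},\\[4pt] 2\sin\frac{|\theta|}{2}, & \sin\frac{|\theta|}{2}<z\le 1.\end{cases}$$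
   Context: A continuous rigid motion transforming the unit segment $A_0B_0$ into the unit segment $A_1B_1$ is described by the trajectories of its endpoints: continuous curves $A,B:[0,1]\to\mathbb{R}^d$ with $A(0)=A_0$, $B(0)=B_0$, $A(1)=A_1$, $B(1)=B_1$ and $|B(t)-A(t)|=1$ for all $t\in[0,1]$. For such a motion, $L(A_0B_0,A_1B_1):=L(A_0)+L(B_0)$ denotes the sum of the lengths of the two curves $A(t)$ and $B(t)$, $t\in[0,1]$ (so this number depends on the motion). Only motions with $L(A_0B_0,A_1B_1)<\infty$ are considered; after a reparametrization, which does not change lengths, $A(t)$ and $B(t)$ are assumed to be Lipschitz. The angle $\theta$ is a signed angle in $(-\pi,\pi]$ between the vectors $\overrightarrow{A_0B_0}$ and $\overrightarrow{A_1B_1}$; only $|\theta|\in[0,\pi]$, the usual unsigned angle between these vectors, matters here. The distance between two lines is the infimum of the distances between a point of one and a point of the other. *)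

(* Defs.v *)
From HB Require Import structures.
From mathcomp Require Import all_boot all_order all_algebra.
From mathcomp Require Import all_classical all_reals all_analysis.
From mathcomp Require Import ring lra.

Set Implicit Arguments.
Unset Strict Implicit.
Unset Printing Implicit Defensive.

Import Order.TTheory GRing.Theory Num.Theory.
Import numFieldNormedType.Exports.

Local Open Scope classical_set_scope.
Local Open Scope ring_scope.

Section Euclidean.
Context {R : realType} {d : nat}.
Implicit Types u v P Q : 'rV[R]_d.

Definition edot u v : R := \sum_(i < d) u ord0 i * v ord0 i.

(* The library's norm on 'rV[R]_d is the sup norm, hence a separate Euclidean
   norm; both induce the product topology, which is the one used by
   [continuous] below. *)
Definition enorm u : R := Num.sqrt (edot u u).

Definition vangle u v : R := acos (edot u v / (enorm u * enorm v)).

Definition line_through P Q : set 'rV[R]_d :=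
  range (fun s : R => P + s *: (Q - P)).

Definition set_dist (X Y : set 'rV[R]_d) : R :=
  inf [set enorm (p - q) | p in X & q in Y].

(* Vector-valued analogues of [variation] and [total_variation]. *)
Definition inscribed_length (a b : R) (f : R -> 'rV[R]_d) (s : seq R) : R :=
  let F := f \o nth b (a :: s) in
  \sum_(0 <= n < size s) enorm (F n.+1 - F n).

Definition curve_length (a b : R) (f : R -> 'rV[R]_d) : \bar R :=
  ereal_sup [set (inscribed_length a b f s)%:E | s in itv_partition a b].

(* Only the restrictions of A and B to [0, 1] matter. *)
Definition rigid_motion (A0 B0 A1 B1 : 'rV[R]_d) (A B : R -> 'rV[R]_d) : Prop :=
  [/\ {within `[0, 1], continuous A},
      {within `[0, 1], continuous B},
      A 0 = A0 /\ B 0 = B0,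
      A 1 = A1 /\ B 1 = B1 &
      forall t, t \in `[0, 1] -> enorm (B t - A t) = 1].

Definition motion_length (A B : R -> 'rV[R]_d) : \bar R :=
  (curve_length 0 1 A + curve_length 0 1 B)%E.

End Euclidean.

Section LowerBound.
Context {R : realType}.
Implicit Types theta h z : R.

Definition ell theta z : R :=
  if z <= sin (`|theta| / 2) then
    2 * z + Num.sqrt (1 - z ^+ 2) * (`|theta| - 2 * asin z)
  else 2 * sin (`|theta| / 2).

Definition objective theta h z : R :=
  Num.max
    (Num.sqrt (4 * (Num.max h z) ^+ 2 + (ell theta z) ^+ 2))
    (2 * acos (Num.sqrt (1 - z ^+ 2) * cos (theta / 2))).

(* The infimum is a minimum: see [F_is_min]. *)
Definition F theta h : R := inf [set objective theta h z | z in `[0, 1]].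

Let clamp (x : R) : R := Num.max (-1) (Num.min 1 x).

Let clampE x : -1 <= x <= 1 -> clamp x = x.
Proof. by move=> /andP[? ?]; rewrite /clamp min_r// max_r. Qed.

Let clamp_bnd x : -1 <= clamp x <= 1.
Proof.
by rewrite /clamp le_max lexx/= ge_max ge_min lexx/= andbT; lra.
Qed.

Let cont_max (f g : R -> R) :
  continuous f -> continuous g -> continuous (fun x => Num.max (f x) (g x)).
Proof. by move=> cf cg x; exact: (continuous_max (cf x) (cg x)). Qed.

Let cont_min (f g : R -> R) :
  continuous f -> continuous g -> continuous (fun x => Num.min (f x) (g x)).
Proof. by move=> cf cg x; exact: (continuous_min (cf x) (cg x)). Qed.

Let cont_cst (a : R) : continuous (fun _ : R => a).
Proof. by move=> x; exact: cvg_cst. Qed.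

Let cont_id : continuous (fun x : R => x).
Proof. by move=> x; exact: cvg_id. Qed.

Let cont_add (f g : R -> R) :
  continuous f -> continuous g -> continuous (fun x => f x + g x).
Proof. by move=> cf cg x; exact: (cvgD (cf x) (cg x)). Qed.

Let cont_sub (f g : R -> R) :
  continuous f -> continuous g -> continuous (fun x => f x - g x).
Proof. by move=> cf cg x; exact: (cvgB (cf x) (cg x)). Qed.

Let cont_mul (f g : R -> R) :
  continuous f -> continuous g -> continuous (fun x => f x * g x).
Proof. by move=> cf cg x; exact: (cvgM (cf x) (cg x)). Qed.

Let cont_comp (f g : R -> R) :
  continuous f -> continuous g -> continuous (fun x => g (f x)).
Proof. by move=> cf cg x; exact: (continuous_comp (cf x) (cg (f x))). Qed.

Let clamp_cont : continuous clamp.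
Proof. exact: (cont_max (@cont_cst _) (cont_min (@cont_cst _) cont_id)). Qed.

Let clamp_comp (g : R -> R) :
  {within `[-1, 1], continuous g} -> continuous (fun x => g (clamp x)).
Proof.
move=> /subspace_continuousP cg x.
have cx : `[-1, 1]%classic (clamp x) by rewrite /= in_itv/=; exact: clamp_bnd.
apply: cvg_trans (cg _ cx) => U /= Ug.
apply: (@filterS _ (nbhs x) _ _ _ _ (clamp_cont Ug)) => y /=; apply.
by rewrite in_itv/=; exact: clamp_bnd.
Qed.

Let acos_clamp_cont : continuous (fun x : R => acos (clamp x)).
Proof.
apply: clamp_comp; rewrite -(cospi R) -(cos0 R).
apply: segment_can_ge_continuous; first exact: pi_ge0.
  exact: continuous_subspaceT (@continuous_cos R).
by move=> x; exact: cosK.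
Qed.

Let asin_clamp_cont : continuous (fun x : R => asin (clamp x)).
Proof.
apply: clamp_comp; rewrite -(sin_pihalf R) -sinN.
apply: segment_can_le_continuous; first by have := pi_ge0 R; lra.
  exact: continuous_subspaceT (@continuous_sin R).
by move=> x; exact: sinK.
Qed.

Let sqrt_1sub_cont (f : R -> R) :
  continuous f -> continuous (fun x => Num.sqrt (1 - f x * f x)).
Proof.
move=> cf; apply: (cont_comp _ (@sqrt_continuous R)).
by apply: cont_sub => //; apply: cont_mul.
Qed.

Lemma F_is_min theta h : `|theta| <= pi ->
  exists2 z, z \in `[0, 1] & F theta h = objective theta h z /\
    forall z', z' \in `[0, 1] -> F theta h <= objective theta h z'.
Proof.
move=> thpi; set s := sin (`|theta| / 2).
have th0 : 0 <= `|theta| by [].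
have s1 : s <= 1 by exact: sin_le1.
have s0 : 0 <= s by rewrite /s sin_ge0_pi//; have := pi_ge0 R; lra.
pose m z := Num.min z s.
have cm : continuous m by exact: cont_min cont_id (@cont_cst _).
pose e z := 2 * m z + Num.sqrt (1 - m z * m z)
  * (`|theta| - 2 * asin (clamp (m z))).
have ce : continuous e.
  apply: cont_add; first exact: cont_mul.
  apply: cont_mul; first exact: sqrt_1sub_cont.
  apply: cont_sub => //; apply: cont_mul => //.
  exact: (cont_comp cm asin_clamp_cont).
have eE z : z \in `[0, 1] -> e z = ell theta z.
  rewrite in_itv/= => /andP[z0 z1]; rewrite /e /ell /m -/s.
  case: (leP z s) => zs; first by rewrite clampE ?expr2//; lra.
  rewrite clampE; last lra.
  rewrite {2}/s sinK; last by rewrite in_itv/=; lra.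
  by rewrite (_ : `|theta| - 2 * (`|theta| / 2) = 0); [lra|field].
pose g z := Num.max
    (Num.sqrt (4 * (Num.max h z * Num.max h z) + e z * e z))
    (2 * acos (clamp (Num.sqrt (1 - z * z) * cos (theta / 2)))).
have cg : continuous g.
  apply: cont_max.
    apply: (cont_comp _ (@sqrt_continuous R)).
    have ch : continuous (fun z => Num.max h z).
      exact: cont_max (@cont_cst _) cont_id.
    apply: cont_add; last exact: cont_mul.
    by apply: cont_mul => //; apply: cont_mul.
  apply: cont_mul => //; apply: (cont_comp _ acos_clamp_cont).
  by apply: cont_mul => //; exact: sqrt_1sub_cont.
have gE z : z \in `[0, 1] -> g z = objective theta h z.
  move=> zI; rewrite /g /objective (eE _ zI) !expr2 clampE//.
  rewrite -ler_norml normrM mulr_ile1//; last first.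
    by rewrite ler_norml cos_geN1 cos_le1.
  rewrite ger0_norm ?sqrtr_ge0// -[leRHS]sqrtr1 ler_wsqrtr//.
  by rewrite gerBl -expr2 sqr_ge0.
have [c cI cmin] := EVT_min ler01 (continuous_subspaceT cg).
have lbc : lbound [set objective theta h z | z in `[0, 1]] (objective theta h c).
  by move=> _ [z zI <-]; rewrite -!gE//; exact: cmin.
have Fc : F theta h = objective theta h c.
  apply/eqP; rewrite eq_le; apply/andP; split.
    by apply: ge_inf; [exists (objective theta h c)|exists c].
  by apply: lb_le_inf => //; exists (objective theta h c), c.
exists c => //; split=> // z zI; rewrite Fc.
by apply: lbc; exists z.
Qed.

End LowerBound.

(* Main.v *)
(* Put u = B - A, choose a unit vector e orthogonal to both segments along which
   A1 - A0 has component at least h, and let z be the maximum of |u . e|, attained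
   at time t.  The components along e contribute at least 2 max(h, z) to the sum of
   the lengths; the components orthogonal to e contribute at least the length of
   the projection of u, which joins u(0) to u(1) outside the ball of radius
   r = sqrt(1 - z^2) and touches that ball at time t.  The two contributions combine
   by Minkowski's inequality.  The length of a curve outside a ball is bounded below
   by calibration, separately on [0, t] and [t, 1]: in polar coordinates (rho, phi)
   the functions r phi +- unwound r rho have unit gradient.  For chords of an
   inscribed polygon this calibration is exact as soon as the radius is replaced by
   some r' < r and the partition is fine enough; then r' tends to r.  The same
   estimate for u itself, outside the unit ball, gives the second term of the
   maximum: u passes through a point at height z above the equator. *)
Require Import Defs.
From mathcomp Require Import all_boot all_order all_algebra.
From mathcomp Require Import all_classical all_reals all_analysis.
From mathcomp Require Import ring lra.

Set Implicit Arguments.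
Unset Strict Implicit.
Unset Printing Implicit Defensive.

Import Order.TTheory GRing.Theory Num.Theory.
Import numFieldNormedType.Exports.

Local Open Scope classical_set_scope.
Local Open Scope ring_scope.

Section EuclideanSpace.
Context {R : realType} {d : nat}.
Implicit Types u v w : 'rV[R]_d.

Lemma edotC u v : edot u v = edot v u.
Proof. by apply: eq_bigr => i _; rewrite mulrC. Qed.

Lemma edotDl u v w : edot (u + v) w = edot u w + edot v w.
Proof. by rewrite -big_split; apply: eq_bigr => i _; rewrite mxE mulrDl. Qed.

Lemma edotZl a u v : edot (a *: u) v = a * edot u v.
Proof. by rewrite mulr_sumr; apply: eq_bigr => i _; rewrite mxE mulrA. Qed.

Lemma edotNl u v : edot (- u) v = - edot u v.
Proof. by rewrite -scaleN1r edotZl mulN1r. Qed.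

Lemma edotDr u v w : edot w (u + v) = edot w u + edot w v.
Proof. by rewrite edotC edotDl !(edotC w). Qed.

Lemma edotZr a u v : edot u (a *: v) = a * edot u v.
Proof. by rewrite edotC edotZl edotC. Qed.

Lemma edotNr u v : edot u (- v) = - edot u v.
Proof. by rewrite edotC edotNl edotC. Qed.

Lemma edot0l v : edot 0 v = 0.
Proof. by rewrite -(scale0r v) edotZl mul0r. Qed.

Lemma edot0r v : edot v 0 = 0.
Proof. by rewrite edotC edot0l. Qed.

Definition edotE := (edotDl, edotDr, edotNl, edotNr, edotZl, edotZr).

Lemma edot_ge0 u : 0 <= edot u u.
Proof. by apply: sumr_ge0 => i _; rewrite -expr2 sqr_ge0. Qed.

Lemma edot_eq0 u : edot u u = 0 -> u = 0.
Proof.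
move=> /psumr_eq0P u0; apply/rowP => i; rewrite mxE.
apply/eqP; rewrite -sqrf_eq0 expr2 u0// => j _.
by rewrite -expr2 sqr_ge0.
Qed.

Lemma enorm_ge0 u : 0 <= enorm u.
Proof. exact: sqrtr_ge0. Qed.

Lemma enormE u : enorm u ^+ 2 = edot u u.
Proof. by rewrite sqr_sqrtr// edot_ge0. Qed.

Lemma enormN u : enorm (- u) = enorm u.
Proof. by rewrite /enorm edotNl edotNr opprK. Qed.

Lemma enormZ a u : enorm (a *: u) = `|a| * enorm u.
Proof.
by rewrite /enorm edotZl edotZr mulrA -expr2 sqrtrM ?sqr_ge0// sqrtr_sqr.
Qed.

Lemma enorm_distC u v : enorm (u - v) = enorm (v - u).
Proof. by rewrite -enormN opprB. Qed.

Lemma le_enorm u x : 0 <= x -> edot u u <= x ^+ 2 -> enorm u <= x.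
Proof. by move=> x0 ux; rewrite -(@ler_pXn2r _ 2) ?nnegrE ?enorm_ge0// enormE. Qed.

Lemma edot_sqr_le u v : edot u v ^+ 2 <= edot u u * edot v v.
Proof.
have [v0|vN0] := eqVneq (edot v v) 0.
  by rewrite (edot_eq0 v0) edot0r edot0l mulr0 expr0n.
have v_gt0 : 0 < edot v v by rewrite lt0r vN0 edot_ge0.
have := edot_ge0 (edot v v *: u - edot u v *: v).
rewrite !edotE (edotC v u) => H.
rewrite -subr_ge0 -(pmulr_rge0 _ v_gt0); apply: le_trans H _.
by rewrite le_eqVlt; apply/orP; left; apply/eqP; ring.
Qed.

Lemma edot_le u v : `|edot u v| <= enorm u * enorm v.
Proof.
rewrite -(@ler_pXn2r _ 2) ?nnegrE ?mulr_ge0 ?enorm_ge0//.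
by rewrite real_normK ?num_real// exprMn !enormE edot_sqr_le.
Qed.

Lemma enormD u v : enorm (u + v) <= enorm u + enorm v.
Proof.
apply: le_enorm; first by rewrite addr_ge0 ?enorm_ge0.
rewrite !edotE (edotC v u) -!enormE.
have := le_trans (ler_norm _) (edot_le u v); lra.
Qed.

Lemma enormB_le u v w : enorm (u - w) <= enorm (u - v) + enorm (v - w).
Proof. by apply: le_trans (enormD _ _); rewrite addrA subrK. Qed.

(* Bessel's inequality, cleared of denominators. *)
Lemma bessel2 (x y q : 'rV[R]_d) : edot x y = 0 -> 0 < edot x x -> 0 < edot y y ->
  edot q x ^+ 2 * edot y y + edot q y ^+ 2 * edot x x
    <= edot q q * (edot x x * edot y y).
Proof.
move=> xy x0 y0.
have := edot_ge0 ((edot x x * edot y y) *: q - (edot y y * edot q x) *: x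
  - (edot x x * edot q y) *: y).
rewrite !edotE (edotC x q) (edotC y q) (edotC y x) xy => H.
have xy0 := mulr_gt0 x0 y0.
rewrite -subr_ge0 -(pmulr_rge0 _ xy0); apply: le_trans H _.
by rewrite le_eqVlt; apply/orP; left; apply/eqP; ring.
Qed.

Lemma enorm_mx_norm_le u : enorm u <= d%:R * `|u|.
Proof.
have H (i : 'I_d) : `|u ord0 i| <= `|u|.
  by rewrite [leRHS]mx_normrE; apply: (le_bigmax _ (fun ij => `|u ij.1 ij.2|) (ord0, i)).
apply: le_enorm; first by rewrite mulr_ge0.
apply: (@le_trans _ _ (\sum_(i < d) `|u| ^+ 2)).
  apply: ler_sum => i _; rewrite -expr2 -[leLHS]real_normK ?num_real//.
  by rewrite ler_pXn2r ?nnegrE.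
rewrite sumr_const card_ord -[leLHS]mulr_natl exprMn ler_wpM2r ?sqr_ge0//.
by rewrite -natrX ler_nat; case: d => // n; rewrite -mulnn leq_pmulr.
Qed.

End EuclideanSpace.

Lemma ler_cos (R : realType) :
  {in `[0, pi] &, {mono (@cos R) : x y /~ y <= x}}.
Proof. by move=> x y xI yI; rewrite !leNgt ltr_cos. Qed.

Section Angles.
Context {R : realType} {d : nat}.
Implicit Types u v w : 'rV[R]_d.

Lemma vangle_cos_bnd u v : -1 <= edot u v / (enorm u * enorm v) <= 1.
Proof.
rewrite -ler_norml normrM normfV (ger0_norm (mulr_ge0 (enorm_ge0 u) (enorm_ge0 v))).
have := edot_le u v; have := mulr_ge0 (enorm_ge0 u) (enorm_ge0 v).
rewrite le_eqVlt => /predU1P[<-|n0]; first by rewrite invr0 mulr0.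
by rewrite ler_pdivrMr// mul1r.
Qed.

Lemma vangle_bnd u v : 0 <= vangle u v <= pi.
Proof. by rewrite acos_ge0 ?acos_lepi ?vangle_cos_bnd. Qed.

Lemma cos_vangle u v : 0 < enorm u -> 0 < enorm v ->
  enorm u * enorm v * cos (vangle u v) = edot u v.
Proof.
move=> u0 v0; rewrite acosK ?in_itv/= ?vangle_cos_bnd//.
by rewrite mulrC divfK// mulf_neq0// gt_eqF.
Qed.

Lemma vangleC u v : vangle u v = vangle v u.
Proof. by rewrite /vangle edotC (mulrC (enorm u)). Qed.

Lemma vangle_le u v x : 0 < enorm u -> 0 < enorm v -> 0 <= x <= pi ->
  enorm u * enorm v * cos x <= edot u v -> vangle u v <= x.
Proof.
move=> u0 v0 x0pi; rewrite -cos_vangle// ler_pM2l ?mulr_gt0//.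
by rewrite ler_cos ?in_itv/= ?vangle_bnd.
Qed.

Lemma vangle_triangle u v w : 0 < enorm u -> 0 < enorm v -> 0 < enorm w ->
  vangle u w <= vangle u v + vangle v w.
Proof.
move=> u0 v0 w0; set a := vangle u v; set b := vangle v w.
have /andP[a0 api] : 0 <= a <= pi := vangle_bnd u v.
have /andP[b0 bpi] : 0 <= b <= pi := vangle_bnd v w.
have [abpi|pi_ab] := leP (a + b) pi; last first.
  by apply: le_trans (ltW pi_ab); case/andP: (vangle_bnd u w).
apply: vangle_le => //; first by rewrite addr_ge0.
have Ea : edot u v = enorm u * enorm v * cos a by rewrite cos_vangle.
have Eb : edot v w = enorm v * enorm w * cos b by rewrite cos_vangle.
have sa : 0 <= sin a by rewrite sin_ge0_pi ?a0.
have sb : 0 <= sin b by rewrite sin_ge0_pi ?b0.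
set N := enorm v ^+ 2.
have N0 : 0 < N by rewrite exprn_gt0.
have vv : edot v v = N by rewrite /N enormE.
pose x := N *: u - edot u v *: v; pose y := N *: w - edot v w *: v.
have xx : edot x x = (N * enorm u * sin a) ^+ 2.
  rewrite /x !edotE vv (edotC v u) -[edot u u]enormE Ea.
  by rewrite !exprMn sin2cos2; rewrite /N; ring.
have yy : edot y y = (N * enorm w * sin b) ^+ 2.
  rewrite /y !edotE vv (edotC w v) -[edot w w]enormE Eb.
  by rewrite !exprMn sin2cos2; rewrite /N; ring.
have nx : enorm x = N * enorm u * sin a.
  by rewrite /enorm xx sqrtr_sqr ger0_norm ?mulr_ge0// ltW.
have ny : enorm y = N * enorm w * sin b.
  by rewrite /enorm yy sqrtr_sqr ger0_norm ?mulr_ge0// ltW.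
have : - (enorm x * enorm y) <= edot x y.
  by have := edot_le x y; rewrite ler_norml => /andP[].
have -> : edot x y = N * (N * edot u w - edot u v * edot v w).
  by rewrite /x /y !edotE vv; ring.
rewrite nx ny Ea Eb cosD => H.
rewrite -subr_ge0 -(pmulr_rge0 _ (mulr_gt0 N0 N0)).
rewrite -subr_ge0 in H; apply: le_trans H _.
by rewrite le_eqVlt; apply/orP; left; apply/eqP; rewrite /N; ring.
Qed.

End Angles.

Section Trig.
Context {R : realType}.
Implicit Types (a b x y s t : R).

Lemma sin_le_id y : 0 <= y -> sin y <= y.
Proof.
move=> y0; pose f := fun x : R => x - sin x.
have df x : is_derive x 1 f (1 - cos x) by apply: is_deriveB.
have : f 0 <= f y.
  apply: (@ger0_derive1_ndecr _ f 0 y) => //.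
  - by move=> x _; rewrite derive1E derive_val subr_ge0 cos_le1.
  apply: continuous_subspaceT => x; apply: differentiable_continuous.
  by apply/derivable1_diffP; exact: (@ex_derive _ _ _ _ _ _ _ (df x)).
by rewrite /f sin0; lra.
Qed.

Lemma mul_cos_le_sin y : 0 <= y <= pi -> y * cos y <= sin y.
Proof.
move=> /andP[y0 ypi]; pose f := fun x : R => sin x - x * cos x.
have df x : is_derive x 1 f (x * sin x).
  rewrite (_ : x * sin x = cos x - (x *: - sin x + cos x *: 1)).
    by apply: is_deriveB.
  by rewrite /GRing.scale/=; ring.
have : f 0 <= f y.
  apply: (@ger0_derive1_ndecr _ f 0 y) => //.
  - move=> x; rewrite in_itv/= => /andP[x0 xy].
    rewrite derive1E derive_val mulr_ge0 ?(ltW x0)// sin_ge0_pi// !ltW//.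
    exact: lt_le_trans ypi.
  apply: continuous_subspaceT => x; apply: differentiable_continuous.
  by apply/derivable1_diffP; exact: (@ex_derive _ _ _ _ _ _ _ (df x)).
by rewrite /f sin0; lra.
Qed.

Lemma unwind_le r P Q b x : 0 <= r -> 0 <= P -> 0 <= Q -> 0 <= b < pi / 2 ->
  Q * cos b = r * sin b -> 0 <= x <= 2 * b ->
  r ^+ 2 * x ^+ 2 + 2 * r * (P - Q) * (x - sin x)
    <= 2 * (r ^+ 2 + P * Q) * (1 - cos x).
Proof.
move=> r0 P0 Q0 /andP[b0 bpi] Qb /andP[x0 xb].
(* In terms of [y = x / 2] the inequality is affine in [P], and [E1] and [E2] are
   its two coefficients; both follow from [y <= tan y] and [tan y <= tan b]. *)
pose y := x / 2; have xE : x = y + y by rewrite /y; lra.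
have y0 : 0 <= y by rewrite /y; lra.
have yb : y <= b by rewrite /y; lra.
have C0 : 0 < cos y by rewrite cos_gt0_pihalf//; lra.
have S0 : 0 <= sin y by rewrite sin_ge0_pi//; lra.
have cb : 0 < cos b by rewrite cos_gt0_pihalf//; lra.
have Sy : sin y <= y by exact: sin_le_id.
have Cy : y * cos y <= sin y by rewrite mul_cos_le_sin//; lra.
have QS : r * sin y <= Q * cos y.
  have : 0 <= sin (b - y) by rewrite sin_ge0_pi//; lra.
  rewrite sinB -(pmulr_rge0 _ cb) => H.
  rewrite -(ler_pM2l cb).
  have : 0 <= r * (sin b * cos y - cos b * sin y).
    by rewrite mulr_ge0// -(pmulr_rge0 _ cb).
  have -> : cos b * (Q * cos y) = Q * cos b * cos y by ring.
  by rewrite Qb; lra.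
have SC := cos2Dsin2 y.
have C1 := cos_le1 y.
have ySC : 0 <= y - sin y * cos y.
  rewrite subr_ge0 (le_trans _ Sy)// -[leRHS]mulr1 ler_wpM2l//.
rewrite xE cosD sinD.
set S := sin y in SC S0 Sy Cy QS ySC *; set C := cos y in SC C0 C1 Cy QS ySC *.
have E1 : 0 <= r * (S ^+ 2 - y ^+ 2) * r + r * (Q * (y - S * C)).
  rewrite -mulrA (mulrC _ r) -mulrDr mulr_ge0//.
  rewrite -(pmulr_rge0 _ C0).
  have -> : C * (r * (S ^+ 2 - y ^+ 2) + Q * (y - S * C)) =
    r * y * (S - y * C) + (Q * C - r * S) * (y - S * C).
    ring: SC.
  by apply: addr_ge0; apply: mulr_ge0; rewrite ?ySC ?subr_ge0 ?mulr_ge0.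
have E2 : 0 <= P * (Q * S ^+ 2 - r * y + r * S * C).
  rewrite mulr_ge0// -(pmulr_rge0 _ C0).
  have -> : C * (Q * S ^+ 2 - r * y + r * S * C) =
    S ^+ 2 * (Q * C - r * S) + r * (S - y * C).
    have -> : r * (S - y * C) = r * (S * (C ^+ 2 + S ^+ 2) - y * C) by rewrite SC mulr1.
    ring.
  by apply: addr_ge0; apply: mulr_ge0; rewrite ?subr_ge0// sqr_ge0.
have EE : C * C - S * S = 1 - 2 * S ^+ 2 by move: SC; lra.
rewrite EE.
lra.
Qed.

End Trig.

Section Unwinding.
Context {R : realType}.
Implicit Types r rho : R.

(* [unwound r rho + r * acos (r / rho)] is the length of the tangent segment from
   a point at distance [rho] to the circle of radius [r], and [acos (r / rho)]
   the angle between the point and the point of tangency. *)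
Definition unwound r rho := Num.sqrt (rho ^+ 2 - r ^+ 2) - r * acos (r / rho).

Lemma unwound_step {d} r (p q : 'rV[R]_d) : 0 < r -> r <= enorm p -> r <= enorm q ->
  vangle p q <= acos (r / enorm p) + acos (r / enorm q) ->
  `|r * vangle p q + unwound r (enorm p) - unwound r (enorm q)| <= enorm (p - q).
Proof.
move=> r0 rp rq; set g := vangle p q.
have p0 := lt_le_trans r0 rp; have q0 := lt_le_trans r0 rq.
have pq : enorm p * enorm q * cos g = edot p q by exact: cos_vangle.
have /andP[g0 _] : 0 <= g <= pi := vangle_bnd p q.
have aux rho : r <= rho ->
    let a := acos (r / rho) in let P := Num.sqrt (rho ^+ 2 - r ^+ 2) in
    [/\ 0 <= a < pi / 2, rho * cos a = r, rho * sin a = P, 0 <= P & rho ^+ 2 = r ^+ 2 + P ^+ 2].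
  move=> rrho a P; have rho0 := lt_le_trans r0 rrho.
  have k0 : 0 < r / rho by rewrite divr_gt0.
  have k1 : r / rho <= 1 by rewrite ler_pdivrMr ?mul1r.
  have kI : -1 <= r / rho <= 1 by rewrite k1 (le_trans _ (ltW k0))//; lra.
  have rr : 0 <= rho ^+ 2 - r ^+ 2 by rewrite subr_ge0 ler_pXn2r ?nnegrE ?(ltW rho0) ?(ltW r0).
  have ca : cos a = r / rho by rewrite acosK ?in_itv.
  split.
  - rewrite acos_ge0//= -[ltRHS]cosK ?in_itv/=; last by have := pi_ge0 R; lra.
    rewrite cos_pihalf ltNge; apply/negP => H.
    have : cos (acos (0 : R)) >= cos a.
      by rewrite ler_cos// in_itv/= acos_ge0 ?acos_lepi//; lra.
    by rewrite ca acosK ?in_itv/=; lra.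
  - by rewrite ca mulrC divfK// gt_eqF.
  - rewrite sin_acos//.
    rewrite -[X in X * _](@ger0_norm _ rho) ?(ltW rho0)// -sqrtr_sqr -sqrtrM ?sqr_ge0//.
    by rewrite /P; congr Num.sqrt; field; rewrite gt_eqF.
  - exact: sqrtr_ge0.
  - by rewrite sqr_sqrtr//; ring.
have [/andP[a0 api] ca sa P0 rhop] := aux _ rp.
have [/andP[b0 bpi] cb sb Q0 rhoq] := aux _ rq.
rewrite /unwound; move: a0 api ca sa P0 rhop b0 bpi cb sb Q0 rhoq.
set a := acos _; set P := Num.sqrt _; set b := acos (r / enorm q); set Q := Num.sqrt _.
move=> a0 api ca sa P0 rhop b0 bpi cb sb Q0 rhoq gab.
rewrite -(@ler_pXn2r _ 2) ?nnegrE ?enorm_ge0// real_normK ?num_real// enormE.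
rewrite !edotE (edotC q p) -[edot p p]enormE -[edot q q]enormE rhop rhoq -pq.
pose x := g - a + b.
have -> : r * g + (P - r * a) - (Q - r * b) = r * x + P - Q by rewrite /x; ring.
have -> : enorm p * enorm q * cos g = (r ^+ 2 + P * Q) * cos x - r * (P - Q) * sin x.
  have -> : g = x + (a - b) by rewrite /x; ring.
  rewrite cosD cosB sinB; transitivity
    ((enorm p * cos a * (enorm q * cos b) + enorm p * sin a * (enorm q * sin b)) * cos x
    - (enorm p * sin a * (enorm q * cos b) - enorm p * cos a * (enorm q * sin b)) * sin x).
    ring.
  by rewrite ca cb sa sb; ring.
have [x0|x0] := leP 0 x.
  have := @unwind_le _ r P Q b x (ltW r0) P0 Q0.
  have -> : Q * cos b = r * sin b by rewrite -sb -cb; ring.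
  have -> : x <= 2 * b by rewrite /x; lra.
  rewrite b0 bpi x0 => /(_ isT erefl isT); lra.
have := @unwind_le _ r Q P a (- x) (ltW r0) Q0 P0.
have -> : P * cos a = r * sin a by rewrite -sa -ca; ring.
have -> : - x <= 2 * a by rewrite /x; lra.
rewrite a0 api oppr_ge0 (ltW x0) cosN sinN => /(_ isT erefl isT); lra.
Qed.

End Unwinding.

Section PartitionSums.
Context {R : realType}.
Implicit Types (c : R -> R -> R) (a b : R) (s : seq R).

Fixpoint psum c a s : R := if s is b :: s' then c a b + psum c b s' else 0.

Lemma psum_cat c a s1 s2 :
  psum c a (s1 ++ s2) = psum c a s1 + psum c (last a s1) s2.
Proof. by elim: s1 a => [|x s IH] a /=; rewrite ?add0r// IH addrA. Qed.

Lemma psumD c c' a s :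
  psum (fun x y => c x y + c' x y) a s = psum c a s + psum c' a s.
Proof. by elim: s a => [|x s IH] a /=; rewrite ?addr0// IH addrACA. Qed.

Lemma psum_ge0 c a s : (forall x y, 0 <= c x y) -> 0 <= psum c a s.
Proof. by move=> c0; elim: s a => //= x s IH a; rewrite addr_ge0. Qed.

Lemma le_psum c c' a s :
  (forall x y, c x y <= c' x y) -> psum c a s <= psum c' a s.
Proof. by move=> cc'; elim: s a => //= x s IH a; rewrite lerD. Qed.

Lemma telescope_le_psum (e : rel R) (g : R -> R) c a s :
  (forall x y, e x y -> g y - g x <= c x y) -> path e a s ->
  g (last a s) - g a <= psum c a s.
Proof.
move=> gc; elim: s a => [|x s IH] a /=; first by rewrite subrr.
by move=> /andP[/gc ax /IH xs]; lra.
Qed.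

Lemma hypot_triangle (x1 y1 x2 y2 : R) :
  Num.sqrt ((x1 + x2) ^+ 2 + (y1 + y2) ^+ 2)
  <= Num.sqrt (x1 ^+ 2 + y1 ^+ 2) + Num.sqrt (x2 ^+ 2 + y2 ^+ 2).
Proof.
set p := Num.sqrt (x1 ^+ 2 + _); set q := Num.sqrt (x2 ^+ 2 + _).
have p0 : 0 <= p by exact: sqrtr_ge0.
have q0 : 0 <= q by exact: sqrtr_ge0.
have pE : p ^+ 2 = x1 ^+ 2 + y1 ^+ 2 by rewrite sqr_sqrtr// addr_ge0 ?sqr_ge0.
have qE : q ^+ 2 = x2 ^+ 2 + y2 ^+ 2 by rewrite sqr_sqrtr// addr_ge0 ?sqr_ge0.
rewrite -[leRHS]ger0_norm ?addr_ge0// -sqrtr_sqr ler_wsqrtr//.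
have : x1 * x2 + y1 * y2 <= p * q.
  apply: le_trans (ler_norm _) _.
  rewrite -(@ler_pXn2r _ 2) ?nnegrE ?mulr_ge0// real_normK ?num_real//.
  rewrite exprMn pE qE -subr_ge0.
  apply: le_trans (sqr_ge0 (x1 * y2 - x2 * y1)) _.
  by rewrite le_eqVlt; apply/orP; left; apply/eqP; ring.
lra.
Qed.

Lemma hypot_psum_le c c' a s :
  Num.sqrt (psum c a s ^+ 2 + psum c' a s ^+ 2)
  <= psum (fun x y => Num.sqrt (c x y ^+ 2 + c' x y ^+ 2)) a s.
Proof.
elim: s a => [|x s IH] a /=; first by rewrite expr0n addr0 sqrtr0.
by apply: le_trans (hypot_triangle _ _ _ _) _; rewrite lerD2l.
Qed.

Lemma norm_psum (f : R -> R) a s :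
  `|f (last a s) - f a| <= psum (fun x y => `|f y - f x|) a s.
Proof.
elim: s a => [|x s IH] a /=; first by rewrite subrr normr0.
have -> : f (last x s) - f a = f x - f a + (f (last x s) - f x) by ring.
by apply: le_trans (ler_normD _ _) _; rewrite lerD2l.
Qed.

Lemma inscribed_lengthE {d} a b (f : R -> 'rV[R]_d) s :
  inscribed_length a b f s = psum (fun x y => enorm (f y - f x)) a s.
Proof.
rewrite /inscribed_length; elim: s a => [|x s IH] a /=; first by rewrite big_geq.
by rewrite big_nat_recl//= -IH.
Qed.

Lemma cousin (P : R -> R -> Prop) a b : a <= b ->
  (forall x, a <= x <= b -> exists2 r, 0 < r & forall y w,
     a <= y <= b -> a <= w <= b -> `|y - x| < r -> `|w - x| < r -> P y w) ->
  exists2 s, itv_partition a b s & path (fun x y => `[< P x y >]) a s.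
Proof.
move=> ab locP; pose e := fun x y : R => (x < y) && `[< P x y >].
pose S := [set x | a <= x <= b /\ exists2 s, path e a s & last a s = x].
have Sa : S a by split; [rewrite lexx|exists [::]].
have supS : has_sup S by split; [exists a|exists b => x [/andP[]]].
have ac : a <= sup S by apply: ub_le_sup Sa; case: supS.
have cb : sup S <= b by apply: ge_sup; [exists a|move=> x [/andP[]]].
suff [_ [s ps sb]] : S b.
  exists s; last by apply: sub_path ps => x y /andP[].
  by split; [apply: sub_path ps => x y /andP[]|rewrite sb].
have [r r0 Pr] := locP (sup S) (introT andP (conj ac cb)).
have [x Sx rx] := sup_adherent r0 supS.
have xc : x <= sup S by apply: ub_le_sup Sx; case: supS.
pose y := Num.min b (sup S + r / 2).
have [yb yr] : y <= b /\ y <= sup S + r / 2 by rewrite /y; split; rewrite ge_min lexx ?orbT.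
have cy : sup S <= y by rewrite /y le_min cb/=; lra.
case: (Sx) => /andP[ax xb] [s ps sx].
have [xy|yx] := ltP x y; last first.
  have yc : y = sup S by apply/eqP; rewrite eq_le cy (le_trans yx xc).
  have : y = b.
    by move: yc; rewrite /y; case: (leP b) => // _; lra.
  move=> yb'; suff -> : b = x by [].
  by apply/eqP; rewrite eq_le xb -yb' yx.
have Sy : S y.
  split; first by rewrite yb (le_trans ax)// ltW.
  exists (rcons s y); last by rewrite last_rcons.
  rewrite rcons_path ps sx /e xy; apply/asboolP/Pr.
  - by rewrite ax xb.
  - by rewrite (le_trans ax (ltW xy)) yb.
  - by rewrite ltr_norml; lra.
  - by rewrite ltr_norml; lra.
have : y <= sup S by apply: ub_le_sup Sy; case: supS.
move=> yc; suff <- : y = b by [].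
by move: yc; rewrite /y; case: (leP b) => // _; lra.
Qed.

End PartitionSums.

Section AvoidingABall.
Context {R : realType} {d : nat}.
Implicit Types (f : R -> 'rV[R]_d) (a b r : R).

Definition econtinuous a b f := forall x, a <= x <= b -> forall eps, 0 < eps ->
  exists2 r, 0 < r & forall y, a <= y <= b -> `|y - x| < r -> enorm (f y - f x) < eps.

Lemma acos_le (x y : R) : -1 <= x -> x <= y -> y <= 1 -> acos y <= acos x.
Proof.
move=> x1 xy y1.
have xI : -1 <= x <= 1 by rewrite x1 (le_trans xy).
have yI : -1 <= y <= 1 by rewrite y1 (le_trans x1).
by rewrite -ler_cos ?in_itv/= ?acos_ge0 ?acos_lepi// !acosK ?in_itv.
Qed.

Lemma vangle_small (p q : 'rV[R]_d) r x : 0 < r -> r <= enorm p -> r <= enorm q ->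
  0 <= x <= pi -> enorm (p - q) ^+ 2 <= 2 * r ^+ 2 * (1 - cos x) -> vangle p q <= x.
Proof.
move=> r0 rp rq xI.
have p0 := lt_le_trans r0 rp; have q0 := lt_le_trans r0 rq.
rewrite enormE !edotE (edotC q p) -[edot p p]enormE -[edot q q]enormE => H.
apply: vangle_le => //.
have c1 : 0 <= 1 - cos x by rewrite subr_ge0 cos_le1.
have : r ^+ 2 * (1 - cos x) <= enorm p * enorm q * (1 - cos x).
  by rewrite ler_wpM2r// expr2 ler_pM// ltW.
have := sqr_ge0 (enorm p - enorm q); lra.
Qed.

Lemma length_avoiding_ball f a b r r' : a <= b -> 0 < r' < r ->
  econtinuous a b f -> (forall x, a <= x <= b -> r <= enorm (f x)) ->
  exists2 s, itv_partition a b s &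
    r' * vangle (f a) (f b) + `|unwound r' (enorm (f a)) - unwound r' (enorm (f b))|
      <= psum (fun x y => enorm (f y - f x)) a s.
Proof.
move=> ab /andP[r'0 r'r] cf rf; have r0 := lt_trans r'0 r'r.
have k0 : 0 < r' / r by rewrite divr_gt0.
have k1 : r' / r < 1 by rewrite ltr_pdivrMr ?mul1r.
pose eta := acos (r' / r).
have eta0 : 0 < eta by rewrite acos_gt0// k1 andbT; lra.
have etapi : eta <= pi / 2.
  by have := @acos_le 0 (r' / r); rewrite acos0; apply; lra.
have c1 : 0 < 1 - cos (2 * eta).
  rewrite subr_gt0 -[ltRHS](cos0 R) ltr_cos ?in_itv/=; have := pi_gt0 R; lra.
pose eps := Num.sqrt (2 * r ^+ 2 * (1 - cos (2 * eta))).
have eps0 : 0 < eps by rewrite sqrtr_gt0 !mulr_gt0// exprn_gt0.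
pose P := fun x y => r <= enorm (f x) /\ r <= enorm (f y) /\ vangle (f x) (f y) <= 2 * eta.
have [|s abs ps] := @cousin _ P a b ab.
  move=> x xI; have [|r1 r10 H] := cf x xI (eps / 2); first by rewrite divr_gt0.
  exists r1 => // y w yI wI yx wx; split; [exact: rf|split; [exact: rf|]].
  apply: (@vangle_small _ _ r) => //; try exact: rf.
    by lra.
  rewrite -[leRHS]sqr_sqrtr -/eps; last by rewrite !mulr_ge0 ?sqr_ge0// ltW.
  rewrite ler_pXn2r ?nnegrE ?enorm_ge0 ?(ltW eps0)//.
  have := enormB_le (f y) (f x) (f w); rewrite (enorm_distC (f x)).
  by have := H y yI yx; have := H w wI wx; lra.
exists s => //; case: (abs) => _ /eqP sb.
have step (p q : 'rV[R]_d) : r <= enorm p -> r <= enorm q -> vangle p q <= 2 * eta ->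
    r' * vangle p q + unwound r' (enorm p) - unwound r' (enorm q) <= enorm (p - q).
  move=> rp rq pq; apply: le_trans (ler_norm _) (unwound_step _ _ _ _) => //.
  - exact: le_trans (ltW r'r) rp.
  - exact: le_trans (ltW r'r) rq.
  have acos_eta rho : r <= rho -> eta <= acos (r' / rho).
    move=> rrho; have rho0 := lt_le_trans r0 rrho.
    apply: acos_le; last exact: ltW.
      by rewrite (@le_trans _ _ 0)// divr_ge0// ltW.
    by rewrite ler_pM2l// lef_pV2.
  by have := acos_eta _ rp; have := acos_eta _ rq; lra.
have tele (sg : R) : `|sg| = 1 ->
    r' * vangle (f a) (f b) + sg * (unwound r' (enorm (f a)) - unwound r' (enorm (f b)))
      <= psum (fun x y => enorm (f y - f x)) a s.
  move=> sg1.
  pose g x := r' * vangle (f a) (f x) - sg * unwound r' (enorm (f x)).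
  have ga : vangle (f a) (f a) = 0.
    have fa0 : 0 < enorm (f a) by rewrite (lt_le_trans r0)// rf// lexx ab.
    by rewrite /vangle -enormE expr2 divff ?acos1// mulf_neq0// gt_eqF.
  have := @telescope_le_psum _ (fun x y => `[< P x y >]) g
    (fun x y => enorm (f y - f x)) a s.
  rewrite sb /g ga => /(_ _ ps) H.
  rewrite (_ : r' * _ + _ = r' * vangle (f a) (f b) - sg * unwound r' (enorm (f b)) -
    (r' * 0 - sg * unwound r' (enorm (f a)))); last by ring.
  apply: H.
  move=> x y /asboolP[rx [ry xy]].
  have fa0 : 0 < enorm (f a) by rewrite (lt_le_trans r0)// rf// lexx ab.
  have := vangle_triangle fa0 (lt_le_trans r0 rx) (lt_le_trans r0 ry).
  rewrite -(ler_pM2l r'0) => tri.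
  have := step _ _ rx ry xy; have := step _ _ ry rx.
  rewrite vangleC => /(_ xy); rewrite (enorm_distC (f x)).
  have [sg0|sg0] := leP 0 sg.
    by move: sg1; rewrite ger0_norm// => ->; lra.
  by move: sg1; rewrite ltr0_norm// => /(canRL opprK) ->; lra.
have := tele 1 (normr1 _); have := tele (-1) (normrN1 _).
by case: (ger0P (unwound r' (enorm (f a)) - _)); lra.
Qed.

End AvoidingABall.

Section Geometry.
Context {R : realType} {d : nat}.
Implicit Types (u v w e p q x y : 'rV[R]_d).

Lemma spherical_detour u v p e (r : R) : 
  enorm u = 1 -> enorm v = 1 -> enorm p = 1 -> enorm e = 1 ->
  edot u e = 0 -> edot v e = 0 -> 0 <= r -> r ^+ 2 = 1 - edot p e ^+ 2 ->
  0 < vangle u v ->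
  2 * acos (r * cos (vangle u v / 2)) <= vangle u p + vangle p v.
Proof.
move=> u1 v1 p1 e1 ue ve r0 rE th0; set th := vangle u v in th0 *.
set al := vangle u p; set be := vangle p v.
have /andP[_ thpi] : 0 <= th <= pi := vangle_bnd u v.
have /andP[al0 alpi] : 0 <= al <= pi := vangle_bnd u p.
have /andP[be0 bepi] : 0 <= be <= pi := vangle_bnd p v.
have [u_gt0 v_gt0 p_gt0] : [/\ 0 < enorm u, 0 < enorm v & 0 < enorm p].
  by rewrite u1 v1 p1.
have thE : edot u v = cos th by rewrite -cos_vangle// u1 v1 !mul1r.
have alE : edot u p = cos al by rewrite -cos_vangle// u1 p1 !mul1r.
have beE : edot p v = cos be by rewrite -cos_vangle// p1 v1 !mul1r.
have tri : th <= al + be by exact: vangle_triangle.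
pose m := (al + be) / 2; pose n := (al - be) / 2; pose t := th / 2.
have [alm bem tht] : [/\ al = m + n, be = m - n & th = t + t].
  by rewrite /m /n /t; split; lra.
have C0 : 0 <= cos t by rewrite cos_ge0_pihalf// /t; lra.
have S0 : 0 < sin t by rewrite sin_gt0_pi// /t; have := pi_gt0 R; lra.
have r1 : r <= 1.
  by rewrite -(@ler_pXn2r _ 2) ?nnegrE// expr1n rE gerBl sqr_ge0.
have rC1 : r * cos t <= 1 by rewrite mulr_ile1// cos_le1.
have rC0 : 0 <= r * cos t by rewrite mulr_ge0.
suff H : cos m <= r * cos t.
  suff : acos (r * cos t) <= m by rewrite -/t /m; lra.
  rewrite -[leRHS]cosK ?in_itv/=; last by rewrite /m; lra.
  by apply: acos_le => //; exact: cos_geN1.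
have [cm0|cm0] := leP (cos m) 0; first exact: le_trans rC0.
have cmt : cos m <= cos t by rewrite ler_cos ?in_itv/=; rewrite /m /t; lra.
have C_gt0 : 0 < cos t by exact: lt_le_trans cmt.
pose qq := p - edot p e *: e.
have qqE : edot qq qq = r ^+ 2.
  by rewrite rE /qq !edotE (edotC e p) -!enormE p1 e1; ring.
have uq : edot qq u = cos al by rewrite /qq !edotE (edotC e u) ue edotC alE; ring.
have vq : edot qq v = cos be by rewrite /qq !edotE (edotC e v) ve beE; ring.
have xyE : edot (u + v) (u - v) = 0.
  by rewrite !edotE (edotC v u) -!enormE u1 v1; ring.
have xxE : edot (u + v) (u + v) = 4 * cos t ^+ 2.
  by rewrite !edotE (edotC v u) -!enormE u1 v1 thE tht cosD; have := cos2Dsin2 t; lra.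
have yyE : edot (u - v) (u - v) = 4 * sin t ^+ 2.
  by rewrite !edotE (edotC v u) -!enormE u1 v1 thE tht cosD; have := cos2Dsin2 t; lra.
have := bessel2 qq xyE; rewrite xxE yyE !mulr_gt0 ?exprn_gt0// => /(_ isT isT).
rewrite qqE (edotDr u v qq) (edotDr u (- v) qq) edotNr uq vq alm bem cosD cosB.
have := cos2Dsin2 m; have := cos2Dsin2 n; have := cos2Dsin2 t.
move: cm0 cmt C_gt0 S0 rC0.
set c := cos m; set k := cos n; set C := cos t.
set S := sin t; set sm := sin m; set sn := sin n.
move=> cm0 cmt C_gt0 S0 rC0 CS ks cs H.
rewrite -(@ler_pXn2r _ 2) ?nnegrE// ?(ltW cm0)// exprMn.
have S20 : 0 < S ^+ 2 by rewrite exprn_gt0.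
rewrite -(ler_pM2l S20).
have K1 : c ^+ 2 * k ^+ 2 * S ^+ 2 + sm ^+ 2 * sn ^+ 2 * C ^+ 2
    <= r ^+ 2 * C ^+ 2 * S ^+ 2 by lra.
apply: (@le_trans _ _ (c ^+ 2 * k ^+ 2 * S ^+ 2 + sm ^+ 2 * sn ^+ 2 * C ^+ 2)); last first.
  by apply: le_trans K1 _; lra.
have c2C2 : c ^+ 2 <= C ^+ 2 by rewrite ler_pXn2r ?nnegrE ?(ltW cm0) ?(ltW C_gt0).
have K2 : c ^+ 2 * S ^+ 2 <= sm ^+ 2 * C ^+ 2.
  have -> : sm ^+ 2 = 1 - c ^+ 2 by lra.
  have -> : S ^+ 2 = 1 - C ^+ 2 by lra.
  lra.
have -> : k ^+ 2 = 1 - sn ^+ 2 by lra.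
have := ler_wpM2l (sqr_ge0 sn) K2; lra.
Qed.

Lemma exists_orthonormal2 u v : (3 <= d)%N ->
  exists e, [/\ enorm e = 1, edot u e = 0 & edot v e = 0].
Proof.
move=> d3; pose M := row_mx u^T v^T.
have kM : kermx M != 0.
  rewrite -mxrank_eq0 mxrank_ker subn_eq0 -ltnNge.
  exact: leq_ltn_trans (rank_leq_col M) _.
have /rowV0Pn[w /sub_kermxP wM w0] := kM.
move: wM; rewrite mul_mx_row -[RHS]row_mx0 => /eq_row_mx[wu wv].
have dotE x : w *m x^T = 0 -> edot x w = 0.
  move=> /matrixP/(_ ord0 ord0); rewrite !mxE => wx.
  rewrite edotC -[RHS]wx; apply: eq_bigr => i _; rewrite mxE//.
have wn : 0 < enorm w.
  rewrite lt0r enorm_ge0 andbT; apply: contra w0 => /eqP w0.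
  by apply/eqP/edot_eq0; rewrite -enormE w0 expr0n.
exists ((enorm w)^-1 *: w); split; rewrite ?edotZr ?(dotE _ wu) ?(dotE _ wv) ?mulr0//.
by rewrite enormZ ger0_norm ?invr_ge0 ?enorm_ge0// mulVf// gt_eqF.
Qed.

Lemma exists_orthogonal_part u v w : enorm u = 1 -> enorm v = 1 ->
  exists s t, edot (w - s *: u - t *: v) u = 0 /\ edot (w - s *: u - t *: v) v = 0.
Proof.
move=> u1 v1; pose c := edot u v.
have uu : edot u u = 1 by rewrite -enormE u1 expr1n.
have vv : edot v v = 1 by rewrite -enormE v1 expr1n.
have [c1|c1] := eqVneq (1 - c ^+ 2) 0.
  exists (edot w u), 0.
  have vE : v = c *: u.
    apply/eqP; rewrite -subr_eq0; apply/eqP/edot_eq0.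
    by rewrite !edotE (edotC v u) -/c uu vv -c1; ring.
  have H : edot (w - edot w u *: u - 0 *: v) u = 0 by rewrite !edotE uu (edotC v u); ring.
  by split => //; rewrite [X in edot _ X]vE edotZr H mulr0.
exists ((edot w u - c * edot w v) / (1 - c ^+ 2)),
  ((edot w v - c * edot w u) / (1 - c ^+ 2)).
by split; rewrite !edotE ?(edotC v u) ?uu ?vv -/c; field.
Qed.

Lemma common_perpendicular (A0 B0 A1 B1 : 'rV[R]_d) : (3 <= d)%N ->
  enorm (B0 - A0) = 1 -> enorm (B1 - A1) = 1 ->
  exists e, [/\ enorm e = 1, edot (B0 - A0) e = 0, edot (B1 - A1) e = 0 &
    set_dist (line_through A0 B0) (line_through A1 B1) <= `|edot (A1 - A0) e|].
Proof.
move=> d3 n0 n1; set u := B0 - A0 in n0 *; set v := B1 - A1 in n1 *.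
have [s [t [wu wv]]] := exists_orthogonal_part (A1 - A0) n0 n1.
set w := _ - _ - _ in wu wv.
have hw : set_dist (line_through A0 B0) (line_through A1 B1) <= enorm w.
  apply: ge_inf; first by exists 0 => _ [p _ [q _ <-]]; exact: enorm_ge0.
  exists (A0 + s *: u); first by exists s.
  exists (A1 + (- t) *: v); first by exists (- t).
  rewrite -[RHS]enormN; congr enorm.
  by apply/rowP => i; rewrite !mxE; ring.
have wE : A1 - A0 = w + t *: v + s *: u by rewrite /w !subrK.
clearbody w u v.
have [w0|w0] := eqVneq (enorm w) 0.
  have [e [e1 ue ve]] := exists_orthonormal2 u v d3.
  by exists e; split => //; rewrite (le_trans hw)// w0.
have w_gt0 : 0 < enorm w by rewrite lt0r w0 enorm_ge0.
exists ((enorm w)^-1 *: w).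
split; rewrite ?edotZr.
- by rewrite enormZ ger0_norm ?invr_ge0 ?enorm_ge0// mulVf.
- by rewrite edotC wu mulr0.
- by rewrite edotC wv mulr0.
- rewrite wE !edotE (edotC u w) (edotC v w) wu wv -enormE.
  rewrite (_ : _^-1 * _ = enorm w); last by field.
  by rewrite ger0_norm ?enorm_ge0.
Qed.

End Geometry.

Section Limits.
Context {R : realType}.

Lemma le_of_left_continuous (f : R -> R) (a r W : R) : a < r ->
  {for r, continuous f} -> (forall x, a < x < r -> f x <= W) -> f r <= W.
Proof.
move=> ar cf fW; rewrite leNgt; apply/negP => Wf.
have : \forall x \near r, W < f x by exact: (cvgr_gt _ cf).
move=> /nbhs_ballP[e /= e0 He].
pose x := Num.max ((a + r) / 2) (r - e / 2).
have x1 : (a + r) / 2 <= x by rewrite /x le_max lexx.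
have x2 : r - e / 2 <= x by rewrite /x le_max lexx orbT.
have xr : x < r by rewrite /x gt_max; apply/andP; split; lra.
have /He : ball r e x by rewrite /ball/= ltr_norml; lra.
by apply/negP; rewrite -leNgt fW//; lra.
Qed.

Lemma unwound_limit (theta r W : R) : 0 < r <= 1 ->
  (forall r', 0 < r' < r -> r' * theta + 2 * (unwound r' 1 - unwound r' r) <= W) ->
  r * theta + 2 * unwound r 1 <= W.
Proof.
move=> /andP[r0 r1] H.
have [re|r_neq1] := eqVneq r 1.
  have -> : r * theta + 2 * unwound r 1 = r * theta.
    by rewrite re /unwound expr1n subrr sqrtr0 divr1 acos1; ring.
  apply: (@le_of_left_continuous (fun x => x * theta) 0) => //.
    by apply: cvgM; [exact: cvg_id|exact: cvg_cst].
  by move=> x /H; rewrite re subrr mulr0 addr0.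
have r_lt1 : r < 1 by rewrite lt_neqAle r_neq1.
pose f x := x * theta + 2 * (Num.sqrt (1 - x * x) - x * acos x)
  - 2 * Num.sqrt (r * r - x * x).
have <- : f r = r * theta + 2 * unwound r 1.
  by rewrite /f /unwound subrr sqrtr0 divr1 expr1n !expr2; ring.
apply: (@le_of_left_continuous f 0) => //.
  have sq (k : R) : {for r, continuous (fun x : R => Num.sqrt (k - x * x))}.
    apply: (@continuous_comp _ _ _ (fun x : R => k - x * x) (@Num.sqrt R));
      last exact: sqrt_continuous.
    by apply: cvgB; [exact: cvg_cst|apply: cvgM; exact: cvg_id].
  apply: cvgB; last by apply: cvgM; [exact: cvg_cst|exact: sq].
  apply: cvgD; first by apply: cvgM; [exact: cvg_id|exact: cvg_cst].
  apply: cvgM; first exact: cvg_cst.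
  apply: cvgB; first exact: sq.
  by apply: cvgM; [exact: cvg_id|apply: continuous_acos; lra].
move=> x /andP[x0 xr]; apply: le_trans (H x _); last by rewrite x0.
rewrite /f /unwound divr1 expr1n !expr2.
have : 0 <= x * acos (x / r).
  have k1 : x / r <= 1 by rewrite ler_pdivrMr ?mul1r// ltW.
  by rewrite mulr_ge0 ?(ltW x0)// acos_ge0// k1 andbT (@le_trans _ _ 0)// divr_ge0// ltW.
lra.
Qed.

End Limits.

Section Projection.
Context {R : realType} {d : nat}.
Implicit Types (f : R -> 'rV[R]_d) (a b : R) (e v w : 'rV[R]_d).

Definition orth_part e v := v - edot v e *: e.

Lemma orth_partB e v w : orth_part e (v - w) = orth_part e v - orth_part e w.
Proof.
by apply/rowP => i; rewrite /orth_part edotDl edotNl !mxE; ring.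
Qed.

Lemma orth_part_id e v : edot v e = 0 -> orth_part e v = v.
Proof. by move=> ve; rewrite /orth_part ve scale0r subr0. Qed.

Lemma enorm_orth_part e v : enorm e = 1 ->
  enorm (orth_part e v) ^+ 2 = enorm v ^+ 2 - edot v e ^+ 2.
Proof.
by move=> e1; rewrite !enormE /orth_part !edotE (edotC e v) -(enormE e) e1; ring.
Qed.

Lemma enorm_orth_part_le e v : enorm e = 1 -> enorm (orth_part e v) <= enorm v.
Proof.
move=> e1; rewrite -(@ler_pXn2r _ 2) ?nnegrE ?enorm_ge0//.
by rewrite enorm_orth_part// gerBl sqr_ge0.
Qed.

Lemma within_econtinuous a b f :
  {within `[a, b], continuous f} -> econtinuous a b f.
Proof.
move=> /subspace_continuousP cf x xI eps eps0.
pose D : R := d%:R + 1.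
have D0 : 0 < D by rewrite /D ltr_wpDl.
have xI' : `[a, b]%classic x by rewrite /= in_itv.
have := cf x xI' => /cvgrPdist_lt/(_ (eps / D)) [|r /= r0 Hr].
  by rewrite divr_gt0.
exists r => // y yI yx.
have /Hr : ball x r y by rewrite /ball/= distrC.
rewrite /= in_itv/= yI => /(_ isT).
rewrite ltr_pdivlMr// distrC => H.
apply: le_lt_trans (enorm_mx_norm_le _) (le_lt_trans _ H).
by rewrite mulrC ler_wpM2l// /D lerDl.
Qed.

Lemma econtinuousB a b f g :
  econtinuous a b f -> econtinuous a b g -> econtinuous a b (fun x => f x - g x).
Proof.
move=> cf cg x xI eps eps0; have e20 : 0 < eps / 2 by rewrite divr_gt0.
have [r1 r10 H1] := cf x xI _ e20; have [r2 r20 H2] := cg x xI _ e20.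
exists (Num.min r1 r2); first by rewrite lt_min r10.
move=> y yI; rewrite lt_min => /andP[y1 y2].
have -> : f y - g y - (f x - g x) = (f y - f x) + (g x - g y).
  by apply/rowP => i; rewrite !mxE; ring.
apply: le_lt_trans (enormD _ _) _; rewrite (enorm_distC (g x)).
by have := H1 y yI y1; have := H2 y yI y2; lra.
Qed.

Lemma econtinuousS a b a' b' f : a <= a' -> b' <= b ->
  econtinuous a b f -> econtinuous a' b' f.
Proof.
move=> aa bb cf x /andP[x1 x2] eps eps0.
have [|r r0 H] := cf x _ eps eps0; first by rewrite (le_trans aa) ?(le_trans x2).
exists r => // y /andP[y1 y2]; apply: H.
by rewrite (le_trans aa) ?(le_trans y2).
Qed.

Lemma econtinuous_orth_part a b e f : enorm e = 1 ->
  econtinuous a b f -> econtinuous a b (fun x => orth_part e (f x)).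
Proof.
move=> e1 cf x xI eps eps0; have [r r0 H] := cf x xI _ eps0.
exists r => // y yI /(H y yI); apply: le_lt_trans.
by rewrite -orth_partB enorm_orth_part_le.
Qed.

Lemma within_continuous_edot a b e f : enorm e = 1 -> econtinuous a b f ->
  {within `[a, b], continuous (fun x => `|edot (f x) e|)}.
Proof.
move=> e1 cf; apply/subspace_continuousP => x; rewrite /= in_itv/= => xI.
apply/cvgrPdist_lt => eps eps0; have [r r0 H] := cf x xI _ eps0.
exists r => //= y /=; rewrite /ball/= distrC => yx; rewrite in_itv/= => yI.
apply: le_lt_trans (H y yI yx).
rewrite distrC; apply: le_trans (ler_dist_dist _ _) _.
by rewrite -edotNl -edotDl (le_trans (edot_le _ _))// e1 mulr1.
Qed.

Lemma hypot_length_le (A B : R -> 'rV[R]_d) e a s : enorm e = 1 ->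
  Num.sqrt ((psum (fun x y => `|edot (A y) e - edot (A x) e|) a s +
             psum (fun x y => `|edot (B y) e - edot (B x) e|) a s) ^+ 2 +
    (psum (fun x y => enorm (orth_part e (B y - A y) - orth_part e (B x - A x))) a s) ^+ 2)
  <= psum (fun x y => enorm (A y - A x)) a s + psum (fun x y => enorm (B y - B x)) a s.
Proof.
move=> e1.
have split_length f : Num.sqrt (psum (fun x y => `|edot (f y) e - edot (f x) e|) a s ^+ 2 +
    psum (fun x y => enorm (orth_part e (f y) - orth_part e (f x))) a s ^+ 2)
    <= psum (fun x y => enorm (f y - f x)) a s.
  apply: le_trans (hypot_psum_le _ _ _ _) _; apply: le_psum => x y.
  rewrite -orth_partB enorm_orth_part// -edotNl -edotDl real_normK ?num_real//.
  by rewrite addrC subrK sqrtr_sqr ger0_norm ?enorm_ge0.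
apply: le_trans (lerD (split_length A) (split_length B)).
apply: le_trans (hypot_triangle _ _ _ _); rewrite ler_wsqrtr// lerD2l.
rewrite ler_pXn2r ?nnegrE ?addr_ge0 ?psum_ge0 => // [|*|*|*]; rewrite ?enorm_ge0//.
rewrite -psumD; apply: le_psum => x y.
rewrite !orth_partB (enorm_distC (orth_part e (A y))).
rewrite [X in enorm X <= _](_ : _ = (orth_part e (A x) - orth_part e (A y)) +
  (orth_part e (B y) - orth_part e (B x))); first exact: enormD.
by apply/rowP => i; rewrite !mxE; ring.
Qed.

End Projection.

Section Bounds.
Context {R : realType}.

Lemma chord_vangle {d} (u v : 'rV[R]_d) : enorm u = 1 -> enorm v = 1 ->
  enorm (v - u) = 2 * sin (vangle u v / 2).
Proof.
move=> u1 v1; pose t := vangle u v / 2.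
have tt : vangle u v = t + t by rewrite /t; lra.
have t0pi : 0 <= t <= pi by have := vangle_bnd u v; rewrite /t; lra.
have uv : edot u v = cos (t + t) by rewrite -tt -cos_vangle ?u1 ?v1// !mul1r.
rewrite -/t -[RHS]ger0_norm ?mulr_ge0 ?sin_ge0_pi// -sqrtr_sqr; congr Num.sqrt.
rewrite !edotE (edotC v u) -!enormE u1 v1 uv cosD.
by have := cos2Dsin2 t; clear; lra.
Qed.

Lemma hypot_length_via {d} (A B : R -> 'rV[R]_d) e t s1 s2 (h : R) : enorm e = 1 ->
  itv_partition 0 t s1 -> itv_partition t 1 s2 ->
  edot (B 0 - A 0) e = 0 -> edot (B 1 - A 1) e = 0 -> 0 <= h ->
  h <= `|edot (A 1 - A 0) e| ->
  Num.sqrt ((2 * Num.max h `|edot (B t - A t) e|) ^+ 2 +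
    (psum (fun x y => enorm (orth_part e (B y - A y) - orth_part e (B x - A x)))
       0 (s1 ++ s2)) ^+ 2)
  <= psum (fun x y => enorm (A y - A x)) 0 (s1 ++ s2)
     + psum (fun x y => enorm (B y - B x)) 0 (s1 ++ s2).
Proof.
move=> e1 [_ /eqP last1] [_ /eqP last2] ue0 ue1 h0 he.
apply: le_trans (hypot_length_le A B 0 (s1 ++ s2) e1).
set P := psum _ _ _ + psum _ _ _; set m := Num.max _ _.
have m0 : 0 <= m by rewrite /m le_max h0.
rewrite ler_wsqrtr// lerD2r.
suff mP : 2 * m <= P.
  by rewrite ler_pXn2r ?nnegrE ?mulr_ge0 ?(le_trans _ mP) ?mulr_ge0.
rewrite /m; case: (leP h _) => _.
  apply: (@le_trans _ _ (psum (fun x y =>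
    `|edot (B y - A y) e - edot (B x - A x) e|) 0 (s1 ++ s2))).
    rewrite psum_cat last1.
    have := norm_psum (fun x => edot (B x - A x) e) 0 s1.
    have := norm_psum (fun x => edot (B x - A x) e) t s2.
    by rewrite last1 last2 ue0 ue1 subr0 sub0r normrN; clear; lra.
  rewrite /P -psumD; apply: le_psum => x y; rewrite !edotE [leRHS]addrC.
  rewrite [X in `|X| <= _](_ : _ = (edot (B y) e - edot (B x) e)
    - (edot (A y) e - edot (A x) e)); last by ring.
  exact: ler_normB.
have := norm_psum (fun x => edot (A x) e) 0 (s1 ++ s2).
have := norm_psum (fun x => edot (B x) e) 0 (s1 ++ s2).
rewrite last_cat last1 last2.
have -> : edot (B 1) e - edot (B 0) e = edot (A 1) e - edot (A 0) e.
  by move: ue0 ue1; rewrite !edotE; clear; lra.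
by move: he; rewrite !edotE /P; clear; lra.
Qed.

Lemma asin_le_half (theta z : R) : 0 <= theta <= pi -> 0 <= z <= sin (theta / 2) ->
  asin z <= theta / 2.
Proof.
move=> /andP[th0 thpi] /andP[z0 zs]; have z1 := le_trans zs (sin_le1 _).
have zI : -1 <= z <= 1 by rewrite z1 (le_trans _ z0)//; clear; lra.
rewrite leNgt; apply/negP => H; move: zs; rewrite leNgt => /negP; apply.
rewrite -[ltRHS]asinK ?in_itv// ltr_sin ?in_itv/= ?asin_geNpi2 ?asin_lepi2//.
by clear -th0 thpi; have := pi_ge0 R; lra.
Qed.

Lemma ell_ge0 (theta z : R) : `|theta| <= pi -> 0 <= z -> 0 <= ell theta z.
Proof.
move=> thpi z0; rewrite /ell; case: ifPn => zs.
  rewrite addr_ge0 ?mulr_ge0 ?sqrtr_ge0// subr_ge0.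
  have := @asin_le_half `|theta| z; rewrite normr_ge0 thpi z0 zs => /(_ isT isT).
  by clear; lra.
rewrite mulr_ge0// sin_ge0_pi//; have := normr_ge0 theta.
by move: thpi; clear; have := pi_ge0 R; lra.
Qed.

Lemma ell_le (theta z W : R) (r := Num.sqrt (1 - z ^+ 2)) : 0 <= z <= 1 ->
  2 * sin (`|theta| / 2) <= W ->
  (forall r', 0 < r' < r ->
     r' * `|theta| + 2 * (unwound r' 1 - unwound r' r) <= W) ->
  ell theta z <= W.
Proof.
move=> /andP[z0 z1] chord H; rewrite /ell; case: ifPn => // zs.
have zz : 0 <= 1 - z ^+ 2 by rewrite subr_ge0 expr_le1.
have r0 : 0 <= r by exact: sqrtr_ge0.
have rE : r ^+ 2 = 1 - z ^+ 2 by rewrite sqr_sqrtr.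
have r1 : r <= 1 by rewrite -(@ler_pXn2r _ 2) ?nnegrE// expr1n rE gerBl sqr_ge0.
rewrite -/r; have [r_eq0|r_neq0] := eqVneq r 0.
  rewrite r_eq0 mul0r addr0; apply: le_trans chord; rewrite ler_pM2l//.
have := @unwound_limit _ `|theta| r W; rewrite r1 lt0r r_neq0 r0 => /(_ isT H).
have zI : -1 <= z <= 1 by rewrite z1 (le_trans _ z0)//; clear; lra.
have zzE : 1 - (1 - z ^+ 2) = z ^+ 2 by ring.
rewrite /unwound divr1 expr1n rE zzE sqrtr_sqr (ger0_norm z0).
have -> : acos r = asin z.
  rewrite /r -cos_asin// cosK// in_itv/=.
  have := asin_lepi2 zI; have := pi_ge0 R.
  have : 0 <= asin z.
    rewrite leNgt; apply/negP => H1.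
    have : sin (asin z) < sin 0.
      by rewrite ltr_sin ?in_itv/= ?asin_geNpi2 ?asin_lepi2//;
        clear; have := pi_ge0 R; lra.
    by rewrite asinK ?in_itv// sin0 ltNge z0.
  by clear; lra.
by clear; lra.
Qed.

End Bounds.

Theorem theorem4 (R : realType) (d : nat) (d_ge3 : (3 <= d)%N)
    (A0 B0 A1 B1 : 'rV[R]_d)
    (unit0 : enorm (B0 - A0) = 1) (unit1 : enorm (B1 - A1) = 1)
    (h : R) (h_ge0 : 0 <= h)
    (hE : h = set_dist (line_through A0 B0) (line_through A1 B1))
    (theta : R) (thetaE : `|theta| = vangle (B0 - A0) (B1 - A1))
    (theta_bnd : 0 < `|theta| <= pi)
    (A B : R -> 'rV[R]_d) (motion : rigid_motion A0 B0 A1 B1 A B)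
    (finite_length : (motion_length A B < +oo)%E) :
  ((F theta h)%:E <= motion_length A B)%E.
Proof.
have [cA cB [A0E B0E] [A1E B1E] AB1] := motion.
have [/andP[th0 thpi]] := theta_bnd.
have insc_le s : itv_partition 0 1 s ->
    ((psum (fun x y => enorm (A y - A x)) 0 s +
      psum (fun x y => enorm (B y - B x)) 0 s)%:E <= motion_length A B)%E.
  move=> ps; rewrite EFinD -!(inscribed_lengthE 0 1).
  by apply: leeD; apply: ereal_sup_ubound; exists s.
case: (motion_length A B) finite_length insc_le => [L _|//|_ insc_le]; last first.
  by have := insc_le _ (itv_partition1 ltr01).
move=> insc_le.
have {insc_le} leL s : itv_partition 0 1 s ->
    psum (fun x y => enorm (A y - A x)) 0 s +
    psum (fun x y => enorm (B y - B x)) 0 s <= L.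
  by move=> /insc_le; rewrite lee_fin.
rewrite lee_fin.
have [e [e1 u0e u1e]] := common_perpendicular d_ge3 unit0 unit1.
rewrite -hE => he.
pose u x := B x - A x.
have u1 x : 0 <= x <= 1 -> enorm (u x) = 1 by move=> xI; apply: AB1; rewrite in_itv.
have u0E : u 0 = B0 - A0 by rewrite /u A0E B0E.
have u1E : u 1 = B1 - A1 by rewrite /u A1E B1E.
rewrite -u0E in u0e thetaE unit0; rewrite -u1E in u1e thetaE unit1.
have cu : econtinuous 0 1 u.
  by apply: econtinuousB; exact: within_econtinuous.
have [t tI tmax] : exists2 t, 0 < t < 1 &
    forall x, 0 <= x <= 1 -> `|edot (u x) e| <= `|edot (u t) e|.
  have [c] := EVT_max ler01 (within_continuous_edot e1 cu).
  rewrite in_itv/= => /andP[c0 c1] cmax.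
  have {}cmax x : 0 <= x <= 1 -> `|edot (u x) e| <= `|edot (u c) e|.
    by move=> xI; apply: cmax; rewrite in_itv.
  have [cz|cz] := eqVneq (edot (u c) e) 0.
    exists (1 / 2); first lra.
    by move=> x /cmax; rewrite cz normr0 => /le_trans; apply.
  exists c => //; rewrite !lt_neqAle c0 c1 !andbT; apply/andP; split.
    by apply: contraNneq cz => <-; rewrite u0e.
  by apply: contraNneq cz => ->; rewrite u1e.
have [t0 t1] := andP tI.
have tI' : 0 <= t <= 1 by rewrite !ltW.
pose z := `|edot (u t) e|; pose r := Num.sqrt (1 - z ^+ 2).
have z0 : 0 <= z by exact: normr_ge0.
have z1 : z <= 1 by apply: le_trans (edot_le _ _) _; rewrite u1// e1 mulr1.
have zz : 0 <= 1 - z ^+ 2 by rewrite subr_ge0 expr_le1.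
have r0 : 0 <= r by exact: sqrtr_ge0.
have rE : r ^+ 2 = 1 - z ^+ 2 by rewrite sqr_sqrtr.
have r1 : r <= 1 by rewrite -(@ler_pXn2r _ 2) ?nnegrE// expr1n rE gerBl sqr_ge0.
have [uz0 uz1] : 0 < enorm (u 0) /\ 0 < enorm (u 1).
  by rewrite !u1 ?lexx ?ler01.
have via s1 s2 : itv_partition 0 t s1 -> itv_partition t 1 s2 ->
    itv_partition 0 1 (s1 ++ s2) by exact: itv_partition_cat.
have psum_via c s1 s2 : itv_partition 0 t s1 ->
    psum c 0 (s1 ++ s2) = psum c 0 s1 + psum c t s2.
  by move=> [_ /eqP lt]; rewrite psum_cat lt.
have length_u s : psum (fun x y => enorm (u y - u x)) 0 s <=
    psum (fun x y => enorm (A y - A x)) 0 s + psum (fun x y => enorm (B y - B x)) 0 s.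
  rewrite -psumD; apply: le_psum => x y; rewrite (enorm_distC (A y)).
  rewrite [X in enorm X <= _](_ : _ = (A x - A y) + (B y - B x)); first exact: enormD.
  by apply/rowP => i; rewrite !mxE; ring.
have cu1 : econtinuous 0 t u by apply: econtinuousS cu => //; exact: ltW.
have cu2 : econtinuous t 1 u by apply: econtinuousS cu => //; exact: ltW.
have sub1 x : 0 <= x <= t -> 0 <= x <= 1 by clear -t1; lra.
have sub2 x : t <= x <= 1 -> 0 <= x <= 1 by clear -t0; lra.
have [zmin _ [_ Fmin]] := F_is_min h thpi.
apply: le_trans (Fmin z _) _; first by rewrite in_itv/= z0.
rewrite /objective ge_max; apply/andP; split; last first.
  have -> : cos (theta / 2) = cos (vangle (u 0) (u 1) / 2).
    by rewrite -thetaE; case: (ger0P theta) => // _; rewrite mulNr cosN.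
  apply: le_trans (spherical_detour unit0 unit1 (u1 t tI') e1 u0e u1e r0 _ _) _ => //.
  - by rewrite rE real_normK ?num_real.
  - by rewrite -thetaE.
  rewrite -[leLHS]mul1r.
  apply: (@le_of_left_continuous _ (fun x => x * _) 0) => //.
    by apply: cvgM; [exact: cvg_id|exact: cvg_cst].
  move=> r' r'I.
  have [|s1 ps1 len1] := length_avoiding_ball (ltW t0) r'I cu1.
    by move=> x /sub1/u1 ->.
  have [|s2 ps2 len2] := length_avoiding_ball (ltW t1) r'I cu2.
    by move=> x /sub2/u1 ->.
  apply: le_trans (leL _ (via _ _ ps1 ps2)); apply: le_trans (length_u _).
  rewrite (psum_via _ _ _ ps1); apply: le_trans (lerD len1 len2).
  by rewrite mulrDr; apply: lerD; rewrite lerDl.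
pose w x := orth_part e (u x); pose len_w := psum (fun x y => enorm (w y - w x)).
pose m := Num.max h z; pose W := Num.sqrt (L ^+ 2 - (2 * m) ^+ 2).
have key s1 s2 : itv_partition 0 t s1 -> itv_partition t 1 s2 ->
    Num.sqrt ((2 * m) ^+ 2 + (len_w 0 s1 + len_w t s2) ^+ 2) <= L.
  move=> ps1 ps2; rewrite -(psum_via _ _ _ ps1).
  apply: le_trans (leL _ (via _ _ ps1 ps2)).
  by apply: hypot_length_via => //; rewrite A0E A1E.
have m0 : 0 <= m by rewrite le_max h_ge0.
have L0 : 0 <= L.
  exact: le_trans (sqrtr_ge0 _) (key _ _ (itv_partition1 t0) (itv_partition1 t1)).
have len_w_ge0 s1 s2 : 0 <= len_w 0 s1 + len_w t s2.
  by rewrite addr_ge0// psum_ge0// => x y; exact: enorm_ge0.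
have mL : 2 * m <= L.
  apply: le_trans (key _ _ (itv_partition1 t0) (itv_partition1 t1)).
  by rewrite -[leLHS]ger0_norm ?mulr_ge0// -sqrtr_sqr ler_wsqrtr// lerDl sqr_ge0.
have W2 : W ^+ 2 = L ^+ 2 - (2 * m) ^+ 2.
  by rewrite sqr_sqrtr// subr_ge0 ler_pXn2r ?nnegrE ?mulr_ge0.
have W0 : 0 <= W by exact: sqrtr_ge0.
have {}key s1 s2 : itv_partition 0 t s1 -> itv_partition t 1 s2 ->
    len_w 0 s1 + len_w t s2 <= W.
  move=> ps1 ps2; rewrite -(@ler_pXn2r _ 2) ?nnegrE// W2 lerBrDl.
  rewrite -[leLHS]sqr_sqrtr ?addr_ge0 ?sqr_ge0//.
  by rewrite ler_pXn2r ?nnegrE ?sqrtr_ge0// key.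
have w0E : w 0 = u 0 by exact: orth_part_id.
have w1E : w 1 = u 1 by exact: orth_part_id.
suff ellW : ell theta z <= W.
  rewrite -[leRHS]ger0_norm// -sqrtr_sqr ler_wsqrtr//.
  have : ell theta z ^+ 2 <= W ^+ 2 by rewrite ler_pXn2r ?nnegrE ?ell_ge0.
  by rewrite W2 -/m; clear; lra.
apply: ell_le => //; first by rewrite z0 z1.
  rewrite thetaE -chord_vangle// -w0E -w1E.
  apply: le_trans (key _ _ (itv_partition1 t0) (itv_partition1 t1)).
  by rewrite /len_w/= !addr0 [leRHS]addrC; exact: enormB_le.
move=> r' r'I; have /andP[_ r'r] := r'I.
have r_gt0 : 0 < r by case/andP: r'I; exact: lt_trans.
have wr x : 0 <= x <= 1 -> r <= enorm (w x).
  move=> xI; rewrite -(@ler_pXn2r _ 2) ?nnegrE ?enorm_ge0//.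
  rewrite enorm_orth_part// u1// expr1n rE lerD2l lerN2.
  by rewrite -[leLHS]real_normK ?num_real// ler_pXn2r ?nnegrE ?tmax.
have wtE : enorm (w t) = r.
  apply/eqP; rewrite -(@eqrXn2 _ 2) ?enorm_ge0//.
  by rewrite enorm_orth_part// u1// expr1n rE real_normK ?num_real.
have cw : econtinuous 0 1 w by exact: econtinuous_orth_part.
have [|x xI|s1 ps1 len1] := length_avoiding_ball (ltW t0) r'I (f := w).
- by apply: econtinuousS cw => //; exact: ltW.
- exact/wr/sub1.
have [|x xI|s2 ps2 len2] := length_avoiding_ball (ltW t1) r'I (f := w).
- by apply: econtinuousS cw => //; exact: ltW.
- exact/wr/sub2.
apply: le_trans (key _ _ ps1 ps2); apply: le_trans (lerD len1 len2).
rewrite w0E w1E wtE unit0 unit1.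
have wt_gt0 : 0 < enorm (w t) by rewrite wtE.
have := vangle_triangle uz0 wt_gt0 uz1; rewrite -thetaE.
have r'0 : 0 <= r' by case/andP: r'I => /ltW.
move=> /(ler_wpM2l r'0).
have := ler_norm (unwound r' 1 - unwound r' r).
have := ler_norm (- (unwound r' r - unwound r' 1)); rewrite normrN.
by clear; lra.
Qed.
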